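(* Let $A\in\mathbb{R}^{d\times d}$ be a matrix whose spectrum contains none of the numbers $2\pi i k$, $k=\pm1,\pm2,\dots$. For any fixed integer $n>0$ it holds $$\psi_1(A)=p_n(A)+2(-1)^{n}\sum_{k=1}^{\infty}\left(\frac{A}{2\pi}\right)^{2(n+1)}\frac{1}{k^{2n}}\left(\left(\frac{A}{2\pi}\right)^2+k^2I_d\right)^{-1},$$ where $$p_n(A)=I_d-\frac12 A+\sum_{i=0}^{n-1}A^{2(i+1)}\frac{B_{2(i+1)}}{(2(i+1))!}.$$
   Context: The function $\psi_1$ is the meromorphic function $\psi_1(z)=\phi_1(z)^{-1}=\dfrac{z}{e^z-1}$, with $\psi_1(0)=1$, where $\phi_1(z)=(e^z-1)/z$; its poles are $2\pi i k$, $k\in\mathbb{Z}\setminus\{0\}$. $\psi_1(A)$ denotes the corresponding (primary/holomorphic functional calculus) matrix function; equivalently $\psi_1(A)=\phi_1(A)^{-1}$. $I_d$ is the $d\times d$ identity matrix. $B_k$ are the Bernoulli numbers, defined by $\dfrac{z}{e^z-1}=\sum_{k=0}^{\infty}B_k\dfrac{z^k}{k!}$ for $|z|<2\pi$ (so $B_1=-\tfrac12$). *)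

(* Defs.v *)
From HB Require Import structures.
From mathcomp Require Import all_boot all_order all_algebra.
From mathcomp Require Import all_classical all_reals all_analysis.
From mathcomp Require Import complex.

Set Implicit Arguments.
Unset Strict Implicit.
Unset Printing Implicit Defensive.

Import Order.TTheory GRing.Theory Num.Theory.
Import numFieldNormedType.Exports.

Local Open Scope classical_set_scope.
Local Open Scope ring_scope.
Local Open Scope complex_scope.

(* Neither library provides the exponential of a complex number. *)
Definition cexp (R : realType) (z : R[i]) : R[i] :=
  (expR (complex.Re z))%:C *
  (cos (complex.Im z) +i* sin (complex.Im z)).

(* Off 0 and the poles 2 i pi k, k <> 0; at a pole the value is junk. *)
Definition psi1 (R : realType) (z : R[i]) : R[i] :=
  if z == 0 then 1 else z / (cexp z - 1).

(* B is the sequence of Bernoulli numbers (with B 1 = -1/2), given by their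
   generating function on the complex disc of radius 2 pi.  The power series
   expansion of psi1 at 0 being unique, at most one sequence qualifies.
   R[i]^o is R[i] with the topology of its modulus. *)
Definition bernoulli_numbers (R : realType) (B : nat -> R) : Prop :=
  forall z : R[i], `|z| < (2 * pi)%:C ->
    series (fun k => (B k)%:C * (z ^+ k / k`!%:R) : R[i]^o) @ \oo
      --> (psi1 z : R[i]^o).

(* (e^z - 1) / z is entire with Taylor expansion sum_k z^k / (k+1)!. *)
Definition phi1_mx (R : realType) (d : nat) (A : 'M[R]_d) : 'M[R]_d :=
  limn (series (fun k => k.+1`!%:R^-1 *: A ^+ k)).

(* Meaningful only when phi1_mx A is invertible, since invmx M is M
   for a singular M. *)
Definition psi1_mx (R : realType) (d : nat) (A : 'M[R]_d) : 'M[R]_d :=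
  invmx (phi1_mx A).

Definition psi1_poly_part (R : realType) (B : nat -> R) (n d : nat)
    (A : 'M[R]_d) : 'M[R]_d :=
  1%:M - 2^-1 *: A
  + \sum_(0 <= i < n) (B (2 * i.+1)%N / (2 * i.+1)`!%:R) *: A ^+ (2 * i.+1).

Definition shifted_square (R : realType) (d : nat) (A : 'M[R]_d) (k : nat) :
    'M[R]_d :=
  ((2 * pi)^-1 *: A) ^+ 2 + (k%:R ^+ 2)%:M.

Definition psi1_term (R : realType) (n d : nat) (A : 'M[R]_d) (k : nat) :
    'M[R]_d :=
  (k%:R ^+ (2 * n))^-1 *:
    (((2 * pi)^-1 *: A) ^+ (2 * n.+1) *m invmx (shifted_square A k)).

(* Main.v *)
Require Import Defs.
From HB Require Import structures.
From mathcomp Require Import all_boot all_order all_algebra.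
From mathcomp Require Import all_classical all_reals all_analysis.
From mathcomp Require Import complex.
From mathcomp Require Import ring lra.

Set Implicit Arguments.
Unset Strict Implicit.
Unset Printing Implicit Defensive.

Import Order.TTheory GRing.Theory Num.Theory.
Import numFieldNormedType.Exports.

Local Open Scope classical_set_scope.
Local Open Scope ring_scope.
Local Open Scope complex_scope.

(** Up to the summand [- A / 2], the function psi1 is the even function
    (z / 2) coth (z / 2), whose Mittag-Leffler expansion is
    1 + 2 sum_k z^2 / (z^2 + 4 pi^2 k^2).  Since A need not be diagonalizable,
    the scalar expansion cannot simply be applied to the eigenvalues, so the
    expansion is obtained for matrices, as a limit of polynomial identities.

    Put N = 2m + 1, u = 1 + z / 2N and v = 1 - z / 2N.  The polynomial
    u^N - v^N vanishes at z = 2iN tan (pi k / N), which gives its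
    factorization into z and the factors z^2 + 4 N^2 tan^2 (pi k / N)
    ([binomial_diff_factor]).  Its logarithmic derivative is a partial fraction
    identity whose polynomial form can be evaluated at A
    ([finite_partial_fractions]).  When m tends to infinity,
    (u^(2N) - 1) / z tends to phi1 A and the nodes 2N tan (pi k / N) tend to
    2 pi k, while staying above this value, so that Tannery's theorem applies to
    the sums ([tannery], [phi1_mx_cvg], [lorentz_sum_cvg]).  The limit is
    phi1 A * (1 - A / 2 + 2 sum_k A^2 (A^2 + 4 pi^2 k^2)^-1) = 1
    ([phi1_mx_partial_fractions]), which also shows that phi1 A is invertible.

    Expanding each term n times by the geometric series in A^2 / (4 pi^2 k^2)
    produces a polynomial whose coefficients are multiples of zeta (2i + 2), and
    the remainder of the theorem ([psi1_mx_expansion]).  It remains to recognize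
    the coefficients as Bernoulli numbers.  For the 1 x 1 matrix x > 0 the
    remainder is O(x^(2n + 2)), so the polynomial agrees with the generating
    series of the Bernoulli numbers up to that order, and the coefficients of
    a power series are determined by its asymptotics at 0
    ([bernoulli_number_coef]). *)

(** * Norms, inverses and dominated series of matrices *)

(** The norm of matrices is the largest absolute value of an entry, so that it is
    submultiplicative only up to the inner dimension. *)
Lemma mx_norm_mul (R : realFieldType) (m n p : nat)
    (A : 'M[R]_(m, n)) (B : 'M[R]_(n, p)) :
  `|A *m B| <= n%:R * `|A| * `|B|.
Proof.
rewrite -[`|_ *m _|]/(mx_norm _) mx_normrE; apply: bigmax_le => [|[i j] _ /=].
  by rewrite !mulr_ge0.
rewrite mxE (le_trans (ler_norm_sum _ _ _))//.
rewrite (@le_trans _ _ (\sum_(k < n) `|A| * `|B|))//.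
  apply: ler_sum => k _; rewrite normrM ler_pM//.
    by rewrite -[`|A|]/(mx_norm _) mx_normrE; apply: (le_bigmax _ _ (i, k)).
  by rewrite -[`|B|]/(mx_norm _) mx_normrE; apply: (le_bigmax _ _ (k, j)).
by rewrite sumr_const card_ord -[leLHS]mulr_natl mulrA.
Qed.

Lemma mx_norm_scalar (R : realFieldType) (d : nat) (a : R) :
  `|a%:M : 'M[R]_d| <= `|a|.
Proof.
rewrite -[`|_%:M|]/(mx_norm _) mx_normrE; apply: bigmax_le => [//|[i j] _ /=].
by rewrite mxE; case: eqP; rewrite ?mulr1n ?mulr0n ?normr0.
Qed.

Lemma mx_norm_expr (R : realFieldType) (d : nat) (A : 'M[R]_d) (k : nat) :
  `|A ^+ k| <= (d%:R * `|A|) ^+ k.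
Proof.
elim: k => [|k ih].
  by rewrite expr0 expr0 (le_trans (mx_norm_scalar _ _))// normr1.
rewrite exprS (le_trans (mx_norm_mul _ _))// exprS ler_wpM2l//.
Qed.

(** A vector v killed by M + E satisfies v = - M^-1 E v, hence has norm at most
    half its own norm; the same inequality applied to (M + E)^-1 gives the bound. *)
Lemma invmx_perturb (R : realFieldType) (d : nat) (M E : 'M[R]_d) :
  M \in unitmx -> d%:R * `|invmx M *m E| <= 2^-1 ->
  (M + E \in unitmx) * (`|invmx (M + E)| <= 2 * `|invmx M|).
Proof.
move=> uM small.
have half_le m (v w : 'M[R]_(d, m)) : v = w - invmx M *m E *m v ->
    `|v| <= 2 * `|w|.
  move=> vE; have : `|v| <= `|w| + 2^-1 * `|v|.
    rewrite {1}vE (le_trans (ler_normB _ _))// lerD2l.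
    by rewrite (le_trans (mx_norm_mul _ _))// ler_wpM2r.
  by move: (`|v|) (`|w|) => a b; lra.
have uME : M + E \in unitmx.
  rewrite -unitmx_tr -row_free_unit; apply/row_freeP.
  apply/row_freeP; rewrite -kermx_eq0; apply/eqP/row_matrixP => i.
  rewrite row0; apply: trmx_inj; rewrite trmx0.
  set v := (row i _)^T.
  have Mv : (M + E) *m v = 0.
    apply: trmx_inj; rewrite trmx_mul /v trmxK trmx0.
    by rewrite -row_mul mulmx_ker row0.
  have vE : v = 0 - invmx M *m E *m v.
    move/eqP : Mv; rewrite mulmxDl addr_eq0 => /eqP /(congr1 (mulmx (invmx M))).
    by rewrite mulKmx// mulmxN mulmxA sub0r.
  by apply/eqP; rewrite -normr_le0 (le_trans (half_le _ _ _ vE))// normr0 mulr0.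
split=> //; apply: half_le.
apply: (can_inj (mulKmx uM)); rewrite mulmxBr mulmxV// !mulmxA mulmxV// mul1mx.
by rewrite -[1%:M](mulmxV uME) mulmxDl addrK.
Qed.

Lemma cvg_mulmx (R : realFieldType) (m n p : nat) (T : Type) (F : set_system T)
    (FF : Filter F) (f : T -> 'M[R]_(m, n)) (g : T -> 'M[R]_(n, p))
    (A : 'M[R]_(m, n)) (B : 'M[R]_(n, p)) :
  f @ F --> A -> g @ F --> B -> (fun t => f t *m g t) @ F --> A *m B.
Proof.
move=> fA gB.
have fA0 := (norm_cvg0P _).2 ((subr_cvg0 _ _).2 fA).
have gB0 := (norm_cvg0P _).2 ((subr_cvg0 _ _).2 gB).
apply/subr_cvg0; apply/norm_cvg0P.
pose a t := `|f t - A|; pose b t := `|g t - B|.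
apply: (@squeeze_cvgr _ _ _ _ (cst 0)
    (fun t => n%:R * (a t * b t + a t * `|B| + `|A| * b t))) => //.
- near=> t; rewrite normr_ge0/=.
  rewrite (_ : _ - _ = (f t - A) *m (g t - B) + (f t - A) *m B + A *m (g t - B)).
    by rewrite !mulrDr !mulrA; do 2?[rewrite (le_trans (ler_normD _ _))// lerD//];
      apply: mx_norm_mul.
  by rewrite -mulmxDr subrK mulmxBl mulmxBr addrA subrK.
- exact: cvg_cst.
- have -> : 0 = n%:R * (0 * 0 + 0 * `|B| + `|A| * 0) :> R.
    by rewrite !(mul0r, mulr0, addr0).
  apply: cvgM; first exact: cvg_cst.
  apply: cvgD; last by apply: cvgM; [exact: cvg_cst|exact: gB0].
  apply: cvgD; first by apply: cvgM; [exact: fA0|exact: gB0].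
  by apply: cvgM; [exact: fA0|exact: cvg_cst].
Unshelve. all: by end_near. Qed.

Lemma cvg_series_dominated (R : realType) (m n : nat) (g : nat -> 'M[R]_(m, n))
    (b : nat -> R) :
  (forall k, `|g k| <= b k) -> cvgn (series b) -> cvgn (series g).
Proof.
move=> gb cb.
have : cvgn (series (fun k => `|g k|)).
  by apply: series_le_cvg cb => // k; rewrite (le_trans _ (gb k)).
move=> /cauchy_cvgP/cauchy_seriesP cg.
apply: cauchy_cvg; apply/cauchy_seriesP => e /cg.
apply: filterS => k /=; rewrite ger0_norm ?sumr_ge0//.
by apply: le_lt_trans; apply: ler_norm_sum.
Qed.

(** Dominated convergence for sums whose number of terms grows with the
    parameter. *)
Lemma tannery (R : realType) (V : normedModType R) (f : nat -> nat -> V)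
    (g : nat -> V) (b : nat -> R) :
  (\forall m \near \oo, forall k, (k < m)%N -> `|f m k| <= b k) ->
  cvgn (series b) -> (forall k, 0 <= b k) ->
  (forall k, f m k @[m --> \oo] --> g k) -> cvgn (series g) ->
  \sum_(0 <= k < m) f m k @[m --> \oo] --> limn (series g).
Proof.
move=> fb cb b0 fg cg.
apply/cvgrPdist_le => e e0.
have e3 : 0 < e / 3 by rewrite divr_gt0.
have [K _ [Kb Kg]] : exists2 K, True &
    (`|limn (series b) - series b K| <= e / 3) /\
    (`|limn (series g) - series g K| <= e / 3).
  have /cvgrPdist_le/(_ _ e3) nb := cb.
  have /cvgrPdist_le/(_ _ e3) ng := cg.
  by have [K HK] := @filter_ex _ _ _ _ (filterI nb ng); exists K.
have /cvgrPdist_le/(_ _ e3) nf :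
    (fun m => \sum_(0 <= k < K) f m k) @ \oo --> series g K.
  by apply: cvg_big => [|k _]; [exact: add_continuous|exact: fg].
near=> m.
have Km : (K <= m)%N by near: m; exact: nbhs_infty_ge.
rewrite (big_cat_nat (n := K))//=.
rewrite (_ : _ - _ = (limn (series g) - series g K)
  + (series g K - \sum_(0 <= k < K) f m k) - \sum_(K <= k < m) f m k); last first.
  by rewrite opprD !addrA subrK.
have -> : e = e / 3 + e / 3 + e / 3 by lra.
rewrite (le_trans (ler_normB _ _))// lerD//.
  rewrite (le_trans (ler_normD _ _))// lerD//.
  by near: m.
rewrite (le_trans (ler_norm_sum _ _ _))//; apply: le_trans Kb.
rewrite (@le_trans _ _ (\sum_(K <= k < m) b k))//.
  rewrite big_nat_cond [leRHS]big_nat_cond; apply: ler_sum => k.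
  rewrite andbT => /andP[_ km].
  by move: k km; near: m.
rewrite ger0_norm ?subr_ge0.
  rewrite -sub_series_geq// lerD2r; apply: nondecreasing_cvgn_le => //.
  exact: nondecreasing_series.
by apply: nondecreasing_cvgn_le => //; exact: nondecreasing_series.
Unshelve. all: by end_near. Qed.

(** * The nodes 2N tan (pi (k + 1) / N) *)

(** By the mean value theorem tan x = x / cos^2 y for some y between 0 and x. *)
Lemma tan_bounds (R : realType) (x : R) : 0 <= x < pi / 2 ->
  x <= tan x <= x * (cos x ^+ 2)^-1.
Proof.
rewrite le_eqVlt => /andP[/predU1P[<- _|x0 x2]].
  by rewrite tan0 mul0r lexx.
have cos_pos (y : R) : 0 <= y <= x -> 0 < cos y.
  move=> /andP[y0 yx]; apply: cos_gt0_pihalf.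
  by rewrite (le_lt_trans yx x2) (lt_le_trans _ y0)// oppr_lt0 divr_gt0 ?pi_gt0.
have := @MVT R tan (fun y => (cos y)^-2) 0 x x0.
case=> [y /[!in_itv]/= /andP[y0 yx]||y /[!in_itv]/= /andP[y0 yx]].
- by apply: is_derive_tan; rewrite gt_eqF// cos_pos// !ltW.
- apply: derivable_within_continuous => y /[!in_itv]/= y0x.
  by apply: derivable_tan; rewrite gt_eqF// cos_pos.
rewrite tan0 !subr0 => ->.
have cy : 0 < cos y by rewrite cos_pos// !ltW.
have cx : 0 < cos x by rewrite cos_pos// ltW/=.
apply/andP; split.
  by rewrite ler_peMl ?(ltW x0)// invf_ge1 ?exprn_gt0//.
rewrite mulrC ler_pM2l// lef_pV2 ?posrE ?exprn_gt0//.
rewrite ler_pXn2r// ?nnegrE ?(ltW cx) ?(ltW cy)//.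
have xpi : x <= pi.
  by rewrite (le_trans (ltW x2))// ler_pdivrMr ?ler_peMr ?pi_ge0// ler1n.
by rewrite ltW// ltr_cos// in_itv/= ?(ltW y0) ?(ltW x0)//= (le_trans (ltW yx)).
Qed.

Definition tan_angle (R : realType) (m k : nat) : R :=
  pi * k.+1%:R / m.*2.+1%:R.

Definition tan_node (R : realType) (m k : nat) : R :=
  2 * m.*2.+1%:R * tan (tan_angle R m k).

Lemma tan_angleE (R : realType) (m k : nat) :
  2 * pi * k.+1%:R = 2 * m.*2.+1%:R * tan_angle R m k.
Proof.
by rewrite /tan_angle -!(mulrA 2) (mulrC m.*2.+1%:R) divfK.
Qed.

Lemma tan_angle_itv (R : realType) (m k : nat) : (k < m)%N ->
  0 < tan_angle R m k < pi / 2.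
Proof.
move=> km; have p0 := pi_gt0 R; rewrite /tan_angle divr_gt0 ?mulr_gt0//=.
rewrite ltr_pdivrMr// -!mulrA ltr_pM2l// mulrC ltr_pdivlMr//.
by rewrite -natrM ltr_nat muln2 ltnS leq_double.
Qed.

Lemma tan_node_gt0 (R : realType) (m k : nat) : (k < m)%N ->
  0 < tan_node R m k.
Proof.
move=> km; have /andP[a0 a2] := tan_angle_itv R km.
apply: mulr_gt0; first by rewrite mulr_gt0.
rewrite (lt_le_trans a0)//.
by have /andP[] := tan_bounds (introT andP (conj (ltW a0) a2)).
Qed.

(** These lower bounds, uniform in m, provide the dominating series in Tannery's
    theorem. *)
Lemma tan_node_ge (R : realType) (m k : nat) : (k < m)%N ->
  2 * pi * k.+1%:R <= tan_node R m k.
Proof.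
move=> km; have /andP[a0 a2] := tan_angle_itv R km.
have /andP[+ _] := tan_bounds (introT andP (conj (ltW a0) a2)).
by rewrite (tan_angleE R m) /tan_node -!mulrA !ler_pM2l.
Qed.

Lemma tan_node_cvg (R : realType) (k : nat) :
  tan_node R m k @[m --> \oo] --> 2 * pi * k.+1%:R.
Proof.
have angle0 : tan_angle R m k @[m --> \oo] --> 0.
  rewrite -[X in _ --> X](mulr0 (pi * k.+1%:R)); apply: cvgM.
    exact: cvg_cst.
  apply: (@squeeze_cvgr _ _ _ _ (cst 0) harmonic) => //.
  - near=> m; rewrite invr_ge0 ler0n/= lef_pV2 ?posrE//.
    by rewrite ler_nat ltnS -addnn leq_addr.
  - exact: cvg_cst.
  - exact: cvg_harmonic.
have cos1 : 2 * pi * k.+1%:R * (cos (tan_angle R m k) ^+ 2)^-1 @[m --> \oo]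
    --> 2 * pi * k.+1%:R.
  rewrite -[X in _ --> X]mulr1; apply: cvgM; first exact: cvg_cst.
  rewrite -[X in _ --> X]invr1; apply: cvgV; first exact: oner_neq0.
  rewrite -[X in _ --> X](expr1n _ 2) -(cos0 R) !expr2.
  have c0 : cos (tan_angle R m k) @[m --> \oo] --> cos 0.
    by apply: continuous_cvg => //; exact: continuous_cos.
  exact: cvgM.
apply: (@squeeze_cvgr _ _ _ _ (cst (2 * pi * k.+1%:R)) _ _ _ _ _ cos1) => //.
- near=> m.
  have km : (k < m)%N by near: m; exact: nbhs_infty_gt.
  rewrite /= tan_node_ge//=; have /andP[a0 a2] := tan_angle_itv R km.
  have /andP[_] := tan_bounds (introT andP (conj (ltW a0) a2)).
  by rewrite (tan_angleE R m) /tan_node -!mulrA !ler_pM2l.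
- exact: cvg_cst.
Unshelve. all: by end_near. Qed.

Lemma tan_node_inj (R : realType) (m : nat) :
  {in gtn m &, injective (tan_node R m)}.
Proof.
move=> j k jm km; rewrite /tan_node => /mulfI e.
have itv i : (i < m)%N -> tan_angle R m i \in `](- (pi / 2)), (pi / 2)[.
  move=> im; have /andP[a0 a2] := tan_angle_itv R im.
  by rewrite in_itv/= a2 andbT (lt_trans _ a0)// oppr_lt0 divr_gt0 ?pi_gt0.
have {}e : tan_angle R m j = tan_angle R m k.
  by apply: tan_inj; rewrite ?itv//; apply: e; rewrite mulf_neq0.
move: e; rewrite /tan_angle => /mulIf; rewrite invr_eq0 pnatr_eq0 => /(_ isT).
move=> /mulfI; rewrite gt_eqF ?pi_gt0// => /(_ isT)/eqP.
by rewrite eqr_nat eqSS => /eqP.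
Qed.

Lemma de_moivre_tan (R : realType) (x : R) (n : nat) : cos x != 0 ->
  (1 +i* tan x) ^+ n = (cos x ^- n)%:C * (cos (x *+ n) +i* sin (x *+ n)).
Proof.
move=> cx0; elim: n => [|n ih]; first by rewrite !mulr0n cos0 sin0 invr1 mulr1.
have cxn0 : cos x ^+ n != 0 by rewrite expf_neq0.
rewrite exprS ih mulrS cosD sinD exprS /tan; apply/eqP.
by rewrite eq_complex/=; apply/andP; split; apply/eqP; field; rewrite cx0 cxn0.
Qed.

(** * Factorization of (1 + X)^N - (1 - X)^N *)

Lemma sum_double (V : nmodType) (F : nat -> V) (p : nat) :
  \sum_(i < p.*2) F i = \sum_(j < p) (F j.*2 + F j.*2.+1).
Proof.
elim: p => [|p ih]; first by rewrite !big_ord0.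
by rewrite doubleS !big_ord_recr/= ih addrA.
Qed.

Lemma odd_binomial_sum (S : comPzRingType) (y : S) (m : nat) :
  2 * y * \sum_(j < m.+1) ('C(m.*2.+1, j.*2.+1)%:R * (y ^+ 2) ^+ j) =
  (1 + y) ^+ m.*2.+1 - (1 - y) ^+ m.*2.+1.
Proof.
pose F i := 1 ^+ (m.*2.+1 - i) * y ^+ i *+ 'C(m.*2.+1, i)
  - 1 ^+ (m.*2.+1 - i) * (- y) ^+ i *+ 'C(m.*2.+1, i).
rewrite !exprDn -sumrB -doubleS (sum_double F) mulr_sumr; apply: eq_bigr => j _.
rewrite /F !expr1n !mul1r -mulrnBl -mulrnBl exprNn -signr_odd odd_double.
rewrite mul1r subrr mul0rn add0r exprNn -signr_odd/= odd_double mulN1r opprK.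
rewrite -mulr2n -exprM mul2n exprS -[RHS]mulr_natl -[in RHS](mulr_natl _ 2).
by rewrite mulrCA !mulrA.
Qed.

(** The polynomial H such that 2 y H(y^2) = (1 + y)^N - (1 - y)^N for
    N = 2m + 1, see [odd_binomial_sum]; it is monic of degree m. *)
Definition odd_binomial_poly (R : nzRingType) (m : nat) : {poly R} :=
  \poly_(j < m.+1) ('C(m.*2.+1, j.*2.+1)%:R : R).

Lemma sin_pi_natmul (R : realType) (n : nat) : sin (pi *+ n : R) = 0.
Proof.
elim: n => [|n ih]; first by rewrite mulr0n sin0.
by rewrite mulrSr sinDpi ih oppr0.
Qed.

(** At y = i tan x the two powers (1 + y)^N and (1 - y)^N are
    e^(iNx) / cos^N x and its conjugate; they are equal as N x is a multiple
    of pi. *)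
Lemma odd_binomial_poly_root (R : realType) (m k : nat) : (k < m)%N ->
  root (odd_binomial_poly R m) (- tan (tan_angle R m k) ^+ 2).
Proof.
move=> km; have /andP[a0 a2] := tan_angle_itv R km.
set x := tan_angle R m k in a0 a2 *.
have cx : 0 < cos x.
  by apply: cos_gt0_pihalf; rewrite a2 andbT (lt_trans _ a0)// oppr_lt0 divr_gt0 ?pi_gt0.
have tx : 0 < tan x by apply: mulr_gt0; rewrite ?invr_gt0// sin_gt0_pihalf// a0.
have xN : x *+ m.*2.+1 = pi *+ k.+1.
  by rewrite -mulr_natr /x /tan_angle divfK// mulr_natr.
have : 2 * (0 +i* tan x) * ((odd_binomial_poly R m).[- tan x ^+ 2])%:C = 0 :> R[i].
  rewrite horner_poly rmorph_sum/=.
  rewrite (eq_bigr (fun j : 'I_m.+1 =>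
      'C(m.*2.+1, j.*2.+1)%:R * ((0 +i* tan x) ^+ 2) ^+ j)) => [|j _].
    rewrite odd_binomial_sum.
    have -> : 1 + (0 +i* tan x) = 1 +i* tan x.
      by apply/eqP; rewrite eq_complex/= add0r addr0 !eqxx.
    have -> : 1 - (0 +i* tan x) = 1 +i* tan (- x).
      by apply/eqP; rewrite eq_complex/= tanN add0r oppr0 addr0 !eqxx.
    rewrite !de_moivre_tan ?cosN ?gt_eqF// mulNrn cosN sinN xN sin_pi_natmul.
    by rewrite oppr0 subrr.
  rewrite rmorphM rmorphXn/= rmorph_nat; congr (_ * _ ^+ _).
  by apply/eqP; rewrite eq_complex/= !(mul0r, mulr0) addr0 sub0r expr2 !eqxx.
move=> /eqP; rewrite mulf_eq0 => /orP[|/eqP/complexI/eqP//].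
rewrite mulf_eq0 pnatr_eq0/= eq_complex/= (gt_eqF tx) andbF//.
Qed.

Lemma odd_binomial_poly_factor (R : realType) (m : nat) :
  odd_binomial_poly R m =
  \prod_(k < m) ('X + (tan (tan_angle R m k) ^+ 2)%:P).
Proof.
pose rs := [seq - tan (tan_angle R m k) ^+ 2 | k : 'I_m].
have lead : (odd_binomial_poly R m)`_m = 1.
  by rewrite coef_poly ltnSn binn.
have sz : size (odd_binomial_poly R m) = m.+1.
  by apply: size_poly_eq; rewrite binn oner_neq0.
have := @all_roots_prod_XsubC _ (odd_binomial_poly R m) rs.
rewrite size_map size_enum_ord sz => ->//.
- rewrite /lead_coef sz lead scale1r /rs big_map enumT.
  by apply: eq_bigr => k _; rewrite polyCN opprK.
- by apply/allP => _ /mapP[k _ ->]; apply: odd_binomial_poly_root.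
- rewrite uniq_rootsE map_inj_uniq ?enum_uniq// => j k /oppr_inj.
  have tpos (i : 'I_m) : 0 < tan (tan_angle R m i).
    by have := tan_node_gt0 R (ltn_ord i); rewrite pmulr_rgt0; last by rewrite mulr_gt0.
  move=> /eqP; rewrite eqrXn2 ?ltW// => /eqP e; apply/val_inj.
  apply: (@tan_node_inj R m); [exact: ltn_ord|exact: ltn_ord|].
  by rewrite /tan_node e.
Qed.

Lemma binomial_diff_factor (R : realType) (m : nat) :
  2 * 'X * \prod_(k < m) ('X^2 + (tan (tan_angle R m k) ^+ 2)%:P) =
  (1 + 'X) ^+ m.*2.+1 - (1 - 'X) ^+ m.*2.+1 :> {poly R}.
Proof.
rewrite -odd_binomial_sum; congr (_ * _).
have /(congr1 (comp_poly 'X^2)) := odd_binomial_poly_factor R m.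
rewrite rmorph_prod/= => e.
rewrite (eq_bigr (fun k : 'I_m =>
  ('X + (tan (tan_angle R m k) ^+ 2)%:P) \Po 'X^2)) => [|k _].
  rewrite -e /odd_binomial_poly poly_def linear_sum/=; apply: eq_bigr => j _.
  by rewrite comp_polyZ comp_Xn_poly scaler_nat mulr_natl.
by rewrite comp_polyD comp_polyX comp_polyC.
Qed.

(** The logarithmic derivative of a product, evaluated where no factor vanishes.
    A morphism f stands for the evaluation, which is at a matrix below. *)
Lemma deriv_prod_logder (R : comNzRingType) (S : unitRingType)
    (f : {rmorphism {poly R} -> S}) (I : Type) (r : seq I) (p : I -> {poly R}) :
  (forall i, f (p i) \is a GRing.unit) ->
  f (\prod_(i <- r) p i)^`() =
  f (\prod_(i <- r) p i) * \sum_(i <- r) f (p i)^`() / f (p i).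
Proof.
move=> up; elim: r => [|i r ih].
  by rewrite !big_nil derivC rmorph0 mulr0.
rewrite !big_cons derivM rmorphD/= mulrDr; congr (_ + _).
  rewrite mulrA -rmorphM [p i * _ * _]mulrC [p i * _]mulrC mulrA.
  by rewrite [in RHS]rmorphM/= mulrK.
by rewrite !rmorphM/= ih mulrA.
Qed.

(** This is (1 + X)^N times the previous factorization, divided by X.  It is this
    product that tends to phi1, the factor (1 + X)^N turning
    the limit sinh (z / 2) / (z / 2) into (e^z - 1) / z. *)
Lemma binomial_factor_cancel (R : realType) (m : nat) :
  (1 + 'X) ^+ m.*2.+1 *
    (2 * \prod_(k < m) ('X^2 + (tan (tan_angle R m k) ^+ 2)%:P)) =
  \sum_(j < m.*2.+1.*2) 'X^j *+ 'C(m.*2.+1.*2, j.+1)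
  + 'X * \sum_(j < m.*2.+1) (1 - 'X^2) ^+ j :> {poly R}.
Proof.
set N := m.*2.+1; have X0 : 'X != 0 :> {poly R} by rewrite polyX_eq0.
(* Both sides are polynomials, so it suffices to compare them after
   multiplication by X. *)
apply: (mulfI X0).
rewrite mulrCA ['X * (2 * _)]mulrCA [2 * ('X * _)]mulrA (binomial_diff_factor R m) -/N.
rewrite mulrBr -exprD addnn -exprMn_comm; last exact: mulrC.
rewrite [RHS]mulrDr [in RHS]mulrA -expr2.
have -> : 'X^2 * (\sum_(j < N) (1 - 'X^2) ^+ j) = 1 - (1 - 'X^2) ^+ N :> {poly R}.
  rewrite -[RHS]opprB subrX1 -[RHS]mulNr; congr (_ * _).
  by rewrite addrAC subrr add0r opprK.
have -> : 'X * \sum_(j < N.*2) 'X^j *+ 'C(N.*2, j.+1) =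
    (1 + 'X) ^+ N.*2 - 1 :> {poly R}.
  rewrite [(1 + 'X) ^+ _]exprDn [in RHS]big_ord_recl/= subn0 expr1n expr0 mulr1 bin0.
  rewrite addrAC subrr add0r mulr_sumr; apply: eq_bigr => j _.
  by rewrite expr1n mul1r mulrnAr -exprS.
have -> : (1 + 'X) * (1 - 'X) = 1 - 'X^2 :> {poly R}.
  by rewrite mulrC -subr_sqr expr1n.
by rewrite addrA subrK.
Qed.

Lemma binomial_diff_deriv (R : realType) (m : nat) :
  let P := \prod_(k < m) ('X^2 + (tan (tan_angle R m k) ^+ 2)%:P) in
  2 * P + 2 * 'X * P^`() =
  ((1 + 'X) ^+ m.*2 + (1 - 'X) ^+ m.*2) *+ m.*2.+1 :> {poly R}.
Proof.
move=> P; have /(congr1 (@deriv R)) := binomial_diff_factor R m.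
rewrite -/P derivM !(derivB, derivD, derivMn, derivM, derivX, deriv_exp) /=.
have -> : (1 : {poly R})^`() = 0 by rewrite derivC.
by rewrite !(add0r, mul0r) mulr1 mul1r mulN1r mulNrn opprK -mulrnDl.
Qed.

(** * Limits of inverses and of binomial sums *)

Lemma invmx_cvg (R : realFieldType) (d : nat) (T : Type) (F : set_system T)
    (FF : Filter F) (M : T -> 'M[R]_d) (P : 'M[R]_d) :
  P \in unitmx -> M @ F --> P ->
  (\forall t \near F, M t \in unitmx) /\ (fun t => invmx (M t)) @ F --> invmx P.
Proof.
move=> uP MP; have MP0 := (@subr_cvg0 _ _ _ _ FF _ _).2 MP.
have MPn := (@norm_cvg0P _ _ _ _ FF _).2 MP0.
have near_small : \forall t \near F, d%:R * `|invmx P *m (M t - P)| <= 2^-1.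
  have : (fun t => d%:R * `|invmx P *m (M t - P)|) @ F --> (0 : R^o).
    rewrite -[X in _ --> X](mulr0 d%:R); apply: cvgM; first exact: cvg_cst.
    apply/norm_cvg0P; rewrite -[X in _ --> X](mulmx0 _ (invmx P)).
    by apply: cvg_mulmx; [exact: cvg_cst|exact: MP0].
  move=> /cvgrPdist_le /(_ 2^-1); rewrite invr_gt0 ltr0n => /(_ isT).
  by apply: filterS => t; rewrite sub0r normrN ger0_norm ?mulr_ge0.
split.
  apply: filterS near_small => t /(invmx_perturb uP)[].
  by rewrite addrC subrK.
apply/subr_cvg0/norm_cvg0P.
pose K := d%:R * (d%:R * (2 * `|invmx P|)) * `|invmx P|.
apply: (@squeeze_cvgr _ _ _ _ (cst 0) (fun t => K * `|M t - P|)).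
- apply: filterS near_small => t /(invmx_perturb uP)[].
  rewrite addrC subrK => uM bM; rewrite normr_ge0/=.
  rewrite (_ : _ - _ = - (invmx (M t) *m (M t - P) *m invmx P)); last first.
    by rewrite mulmxBr mulVmx// mulmxBl mul1mx -mulmxA mulmxV// mulmx1 opprB.
  rewrite normrN (le_trans (mx_norm_mul _ _))//.
  rewrite [K * _]mulrAC ler_wpM2r// -!mulrA ler_wpM2l//.
  rewrite (le_trans (mx_norm_mul _ _))// -mulrA ler_wpM2l// mulrA ler_wpM2r//.
- exact: cvg_cst.
- rewrite -[X in _ --> X](mulr0 K); apply: cvgM; first exact: cvg_cst.
  exact: MPn.
Qed.

Lemma cvg_series_invsq (R : realType) :
  cvgn (series (fun k => (k.+1%:R ^+ 2)^-1 : R)).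
Proof.
(* 1 / (k + 1)^2 <= v k - v (k + 1), so the partial sums telescope. *)
pose v k : R := (k.+1%:R)^-1 * 2.
apply: (@nondecreasing_is_cvgn R) => [|].
  by apply: nondecreasing_series => k _ _; rewrite invr_ge0 exprn_ge0.
exists 2 => _ [n _ <-].
rewrite (@le_trans _ _ (2 - v n))//; last first.
  by rewrite gerBl /v mulr_ge0// invr_ge0.
elim: n => [|n ih].
  by rewrite /series/= big_geq// /v invr1 mul1r subrr.
rewrite seriesSr (le_trans (lerD ih (lexx _)))// /v.
have n0 : 0 < n.+1%:R :> R by [].
rewrite -[n.+2]addn1 natrD; move: (n.+1%:R) n0 (ler1n R n.+1) => x x0 x1.
rewrite -subr_ge0.
have -> : 2 - (x + 1)^-1 * 2 - (2 - x^-1 * 2 + (x ^+ 2)^-1) =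
    (x - 1) / (x ^+ 2 * (x + 1)).
  by field; rewrite !gt_eqF// addr_gt0.
by rewrite divr_ge0 ?subr_ge0// mulr_ge0 ?exprn_ge0 ?addr_ge0// ltW.
Qed.

Lemma ffact_le_expn (n k : nat) : (n ^_ k <= n ^ k)%N.
Proof.
elim: k => [|k ih]; first by rewrite ffactn0.
by rewrite ffactnSr expnSr leq_mul// leq_subr.
Qed.

Lemma binomial_quotient_le (R : realFieldType) (n k : nat) : (0 < n)%N ->
  'C(n, k)%:R / n%:R ^+ k <= (k`!%:R)^-1 :> R.
Proof.
move=> n0; rewrite ler_pdivrMr ?exprn_gt0 ?ltr0n// mulrC.
rewrite ler_pdivlMr ?ltr0n ?fact_gt0//.
by rewrite -natrM bin_ffact -natrX ler_nat ffact_le_expn.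
Qed.

Lemma binomial_quotient_cvg (R : realType) (k : nat) :
  ('C(n, k)%:R / n%:R ^+ k : R) @[n --> \oo] --> (k`!%:R^-1 : R).
Proof.
have ff : ((n ^_ k)%:R / n%:R ^+ k : R) @[n --> \oo] --> (1 : R).
  elim: k => [|k ih].
    by under eq_fun do rewrite ffactn0 expr0 divr1; exact: cvg_cst.
  have : ((n ^_ k)%:R / n%:R ^+ k * (1 - k%:R * n%:R^-1) : R) @[n --> \oo]
      --> (1 * (1 - k%:R * 0) : R).
    apply: cvgM => //; apply: cvgB; first exact: cvg_cst.
    apply: cvgM; first exact: cvg_cst.
    rewrite -(cvg_shiftS (fun n => n%:R^-1 : R)).
    exact: cvg_harmonic.
  rewrite mulr0 subr0 mulr1; apply: cvg_trans; apply: near_eq_cvg.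
  near=> n.
  have n0 : (0 < n)%N by near: n; exact: nbhs_infty_gt.
  have kn : (k <= n)%N by near: n; exact: nbhs_infty_ge.
  have nn0 : n%:R != 0 :> R by rewrite pnatr_eq0 -lt0n.
  rewrite ffactnSr natrM natrB// exprSr.
  have : n%:R ^+ k != 0 :> R by rewrite expf_neq0.
  by move=> ?; field; apply/andP.
have -> : k`!%:R^-1 = 1 * k`!%:R^-1 :> R by rewrite mul1r.
have : ((n ^_ k)%:R / n%:R ^+ k * k`!%:R^-1 : R) @[n --> \oo]
    --> (1 * k`!%:R^-1 : R).
  by apply: cvgM => //; exact: cvg_cst.
apply: cvg_trans; apply: near_eq_cvg; near=> n.
by rewrite -bin_ffact natrM mulrAC mulfK// pnatr_eq0 -lt0n fact_gt0.
Unshelve. all: by end_near. Qed.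

(** The sum is ((1 + A / n)^n - 1) / A, with the division by A carried out on
    the binomial expansion because A may be singular. *)
Lemma phi1_mx_cvg (R : realType) (d : nat) (A : 'M[R]_d) :
  cvgn (series (fun k => k.+1`!%:R^-1 *: A ^+ k)) /\
  \sum_(0 <= j < n) ('C(n, j.+1)%:R / n%:R ^+ j.+1) *: A ^+ j @[n --> \oo]
    --> phi1_mx A.
Proof.
pose b j := exp_coeff (d%:R * `|A|) j.
have bE (c : R) j : 0 <= c <= j.+1`!%:R^-1 -> `|c *: A ^+ j| <= b j.
  move=> /andP[c0 c1]; rewrite normrZ ger0_norm// /b /exp_coeff/= mulrC.
  rewrite ler_pM// ?mx_norm_expr// (le_trans c1)//.
  by rewrite lef_pV2 ?posrE ?ltr0n ?fact_gt0// ler_nat factS leq_pmull.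
have cs : cvgn (series (fun k => k.+1`!%:R^-1 *: A ^+ k)).
  apply: (cvg_series_dominated (b := b)); last exact: is_cvg_series_exp_coeff.
  by move=> k; apply: bE; rewrite invr_ge0 ler0n lexx.
split=> //; apply: (tannery (b := b)) => //.
- near=> n => j jn; apply: bE; rewrite divr_ge0 ?exprn_ge0//=.
  apply: binomial_quotient_le; exact: leq_trans jn.
- exact: is_cvg_series_exp_coeff.
- by move=> k; rewrite /b /exp_coeff/= divr_ge0// exprn_ge0// mulr_ge0.
- move=> k; apply: cvgZ; last exact: cvg_cst.
  exact: binomial_quotient_cvg.
Unshelve. all: by end_near. Qed.

(** * The finite partial fraction identity *)

(** The summand z^2 / (z^2 + c) of the partial fraction expansions. *)
Definition lorentz_mx (R : fieldType) (d : nat) (A : 'M[R]_d) (c : R) : 'M[R]_d :=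
  A ^+ 2 *m invmx (A ^+ 2 + c%:M).

(** Let Q be the value at Y of the product of the factors X^2 + t_k^2.  Then
    [binomial_diff_deriv] computes Q (2 + 4 sum_k Y^2 / (Y^2 + t_k^2)) and
    [binomial_diff_factor] computes Q A, so that the left-hand side reduces to
    u^N (u^(N-1) + v^(N-1) - u^N + v^N) / 2, with u = 1 + Y and v = 1 - Y. *)
Lemma finite_partial_fractions (R : realType) (d : nat) (A : 'M[R]_d.+1)
    (m : nat) :
  let N := m.*2.+1 in
  let Y := N.*2%:R^-1 *: A in
  (forall k, (k < m)%N -> A ^+ 2 + (tan_node R m k ^+ 2)%:M \in unitmx) ->
  (\sum_(0 <= j < N.*2) ('C(N.*2, j.+1)%:R / N.*2%:R ^+ j.+1) *: A ^+ j
    + N.*2%:R^-1 *: (Y * \sum_(j < N) (1 - Y ^+ 2) ^+ j))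
  * (1 - 2^-1 *: A
     + 2 *: \sum_(0 <= k < m) lorentz_mx A (tan_node R m k ^+ 2))
  = (1 - Y ^+ 2) ^+ m.*2 * (1 + Y) * (1 - 2^-1 *: Y)
    - 2^-1 *: ((1 + Y) ^+ N * (1 + Y) ^+ m.*2 * Y).
Proof.
move=> N Y uA; set e : R := N.*2%:R^-1.
have M0 : N.*2%:R != 0 :> R by rewrite pnatr_eq0 -muln2 muln_eq0.
have eM : e * (2 * N%:R) = 1 by rewrite -natrM mul2n mulVf.
have AY : A = (2 * N%:R) *: Y by rewrite scalerA mulrC -/e eM scale1r.
pose h : {rmorphism {poly R} -> 'M[R]_d.+1} := horner_mx Y.
have hX : h 'X = Y by rewrite /h/= horner_mx_X.
pose p (k : 'I_m) : {poly R} := 'X^2 + (tan (tan_angle R m k) ^+ 2)%:P.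
pose P := \prod_(k < m) p k.
have hp k : h (p k) = e ^+ 2 *: (A ^+ 2 + (tan_node R m k ^+ 2)%:M).
  rewrite rmorphD/= rmorphXn/= horner_mx_X horner_mx_C scalerDr.
  rewrite /Y exprZn -/e; congr (_ + _); rewrite scale_scalar_mx -exprMn.
  by rewrite /tan_node mulrA eM mul1r.
have e0 : e != 0 by rewrite invr_eq0.
have uh k : h (p k) \is a GRing.unit.
  by rewrite hp scaler_unit ?uA// unitfE expf_neq0.
have G k : Y ^+ 2 / h (p k) = lorentz_mx A (tan_node R m k ^+ 2).
  rewrite hp invrZ ?unitfE ?expf_neq0//; last exact: uA.
  by rewrite /Y exprZn -scalerAl -scalerAr scalerA mulfV ?expf_neq0// scale1r.
pose S := \sum_(k < m) lorentz_mx A (tan_node R m k ^+ 2).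
have -> : \sum_(0 <= k < m) lorentz_mx A (tan_node R m k ^+ 2) = S.
  by rewrite big_mkord.
(* The analogue, up to the factor 2N, of cosh (A / 2). *)
have Q1 : h P * (1 + 2 *: S) *+ 2 = h (((1 + 'X) ^+ m.*2 + (1 - 'X) ^+ m.*2) *+ N).
  rewrite -(binomial_diff_deriv R m) -/P rmorphD/= !rmorphM/= rmorph_nat hX.
  rewrite -/P (deriv_prod_logder _ uh) -/P.
  have -> : \sum_(k < m) h (p k)^`() / h (p k) = \sum_(k < m) (Y *+ 2) / h (p k).
    by apply: eq_bigr => k _; rewrite derivD derivC addr0 derivXn rmorphMn/= hX.
  rewrite mulrDr mulr1 mulrnDl mulr_natl; congr (_ + _).
  have cYP : Y * h P = h P * Y by rewrite -hX -!rmorphM mulrC.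
  rewrite -(mulrA 2) (mulrA Y) cYP mulr_natl; congr (_ *+ 2).
  rewrite -mulrA; congr (_ * _); rewrite mulr_sumr scaler_sumr.
  by apply: eq_bigr => k _; rewrite -G mulrA mulrnAr -expr2 mulrnAl scaler_nat.
(* The analogue, up to the factor 2N, of sinh (A / 2). *)
have Q2 : h P * A = h ((1 + 'X) ^+ N - (1 - 'X) ^+ N) *+ N.
  rewrite -(binomial_diff_factor R m) -/P -mulrA [_ * P]mulrC !rmorphM/= rmorph_nat hX.
  by rewrite {1}AY -scalerAr -scalerA !scaler_nat mulr_natl mulrnAC.
have T1 : \sum_(0 <= j < N.*2) ('C(N.*2, j.+1)%:R / N.*2%:R ^+ j.+1) *: A ^+ j
    + e *: (Y * \sum_(j < N) (1 - Y ^+ 2) ^+ j)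
    = e *: h ((1 + 'X) ^+ N * (2 * P)).
  rewrite (binomial_factor_cancel R m) -/N rmorphD/= rmorphM/= !rmorph_sum/= hX.
  rewrite scalerDr; congr (_ + _ *: (_ * _)).
    rewrite big_mkord scaler_sumr; apply: eq_bigr => j _.
    rewrite rmorphMn/= rmorphXn/= hX /Y exprZn -scalerMnr scalerA scalerMnl -/e.
    by rewrite -exprS /e exprVn -[in RHS]mulr_natl.
  apply: eq_bigr => j _.
  by rewrite rmorphXn/= rmorphB/= rmorphXn/= rmorph1 hX.
rewrite T1 rmorphM/= [h (2 * P)]rmorphM/= rmorph_nat mulr_natl.
have -> : e *: (h ((1 + 'X) ^+ N) * (h P *+ 2)) * (1 - 2^-1 *: A + 2 *: S)
  = e *: (h ((1 + 'X) ^+ N) * (h P * (1 + 2 *: S) *+ 2 - h P * A)).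
  rewrite -scalerAl -mulrA; congr (_ *: (_ * _)).
  rewrite addrAC mulrDr mulrnAl; congr (_ + _).
  by rewrite mulrN mulrnAl -scalerAr -scaler_nat scalerA mulfV ?scale1r.
rewrite Q1 Q2 -(rmorphMn h) -(rmorphB h) -mulrnBl -(rmorphM h) mulrnAr.
have -> : (1 + 'X) ^+ N * ((1 + 'X) ^+ m.*2 + (1 - 'X) ^+ m.*2
    - ((1 + 'X) ^+ N - (1 - 'X) ^+ N))
  = (1 - 'X^2) ^+ m.*2 * (1 + 'X) * (2 - 'X)
    - (1 + 'X) ^+ N * (1 + 'X) ^+ m.*2 * 'X :> {poly R}.
  have -> : 1 - 'X^2 = (1 + 'X) * (1 - 'X) :> {poly R}.
    by rewrite mulrC -subr_sqr expr1n.
  rewrite exprMn /N !exprS.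
  by move: ((1 + 'X) ^+ m.*2) ((1 - 'X) ^+ m.*2) => u v; ring.
have half : e * N%:R = 2^-1 
  by apply: (@mulfI _ 2) => //; rewrite mulrCA eM mulfV.
rewrite (rmorphMn h) -scaler_nat scalerA half.
rewrite (rmorphB h) !(rmorphM h) !(rmorphXn h) !(rmorphB h) (rmorph_nat h).
rewrite !(rmorphD h) !(rmorphXn h) !(rmorph1 h) !hX scalerBr; congr (_ - _).
have two : 2^-1 *: (2 : 'M[R]_d.+1) = 1.
  by rewrite -scalerMnr scalerMnl -mulr_natr mulVf ?scale1r.
by rewrite scalerAr scalerBr two.
Qed.

(** * Vanishing of the correction terms *)

(** The identity has norm at most 1, so that expanding the power by the binomial
    formula avoids a factor d^j. *)
Lemma mx_norm_expr1D (R : realType) (d : nat) (Z : 'M[R]_d) (x : R) (n j : nat) :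
  n%:R * (d%:R * `|Z|) <= x -> (j <= n)%N -> `|(1 + Z) ^+ j| <= expR x.
Proof.
move=> nx jn; set z := d%:R * `|Z|; have z0 : 0 <= z by rewrite mulr_ge0.
rewrite (@le_trans _ _ ((1 + z) ^+ j))//.
  rewrite exprDn_comm; last exact/commr_sym/commr1.
  rewrite exprDn (le_trans (ler_norm_sum _ _ _))//; apply: ler_sum => i _.
  by rewrite !expr1n !mul1r normrMn lerMn2r mx_norm_expr orbT.
rewrite (@le_trans _ _ (expR z ^+ j))//.
  by rewrite lerXn2r ?nnegrE ?expR_ge0 ?expR_ge1Dx// addr_ge0.
by rewrite -expRM_natl ler_expR (le_trans _ nx)// ler_wpM2r// ler_nat jn.
Qed.

Lemma mx_norm_sum_expr1D (R : realType) (d : nat) (Z : 'M[R]_d) (x : R) (n : nat) :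
  n%:R * (d%:R * `|Z|) <= x -> `|\sum_(j < n) (1 + Z) ^+ j| <= n%:R * expR x.
Proof.
move=> nx; rewrite (le_trans (ler_norm_sum _ _ _))//.
rewrite (@le_trans _ _ (\sum_(j < n) expR x))//; last first.
  by rewrite sumr_const card_ord mulr_natl.
by apply: ler_sum => j _; apply: mx_norm_expr1D nx (ltnW (ltn_ord j)).
Qed.

Section vanishing_corrections.
Variables (R : realType) (d : nat) (A : 'M[R]_d.+1).
Let N m := m.*2.+1.
Let e m : R := (N m).*2%:R^-1.
Let Y m : 'M[R]_d.+1 := e m *: A.
Let a := d.+1%:R * `|A|.

Let e_ge0 m : 0 <= e m. Proof. by rewrite invr_ge0. Qed.
Let a_ge0 : 0 <= a. Proof. by rewrite mulr_ge0. Qed.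

Let e_cvg0 : e @ \oo --> 0.
Proof.
apply: (@squeeze_cvgr _ _ _ _ (cst 0) harmonic) => //.
- near=> m; rewrite e_ge0/= /e /harmonic/= lef_pV2 ?posrE// ler_nat.
  by rewrite /N -!addnn -addSn -addnA leq_addr.
- exact: cvg_cst.
- exact: cvg_harmonic.
Unshelve. all: by end_near. Qed.

Let e_le1 m : e m <= 1.
Proof. by rewrite invf_le1// ler1n. Qed.

Let eN_le1 m : (N m)%:R * e m <= 1.
Proof. by rewrite /e ler_pdivrMr// mul1r ler_nat -addnn leq_addr. Qed.

Let normY m : d.+1%:R * `|Y m| = e m * a.
Proof. by rewrite normrZ ger0_norm// mulrCA. Qed.

Let normY2 m : d.+1%:R * `|- (Y m ^+ 2)| <= e m ^+ 2 * a ^+ 2.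
Proof.
rewrite normrN exprS expr1 (le_trans (ler_wpM2l _ (mx_norm_mul _ _)))//.
by rewrite mulrCA !normY mulrACA -!expr2.
Qed.

Let normY2N m : (N m)%:R * (d.+1%:R * `|- (Y m ^+ 2)|) <= a ^+ 2.
Proof.
rewrite (le_trans (ler_wpM2l _ (normY2 m)))//.
have -> : (N m)%:R * (e m ^+ 2 * a ^+ 2) = (N m)%:R * e m * e m * a ^+ 2 by ring.
rewrite -[leRHS]mul1r ler_wpM2r ?exprn_ge0// mulr_ile1 ?mulr_ge0//.
Qed.

Let cvg0_of_le (f : nat -> 'M[R]_d.+1) (K : R) :
  (forall m, `|f m| <= K * e m) -> f @ \oo --> (0 : 'M[R]_d.+1).
Proof.
move=> fK; apply/norm_cvg0P.
apply: (@squeeze_cvgr _ _ _ _ (cst 0) (fun m => K * e m)).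
- by near=> m; rewrite normr_ge0 fK.
- exact: cvg_cst.
- by rewrite -[X in _ --> X](mulr0 K); apply: cvgM => //; exact: cvg_cst.
Unshelve. all: by end_near. Qed.

Let Y_cvg0 : Y @ \oo --> (0 : 'M[R]_d.+1).
Proof.
by apply: (@cvg0_of_le _ `|A|) => m; rewrite normrZ ger0_norm// mulrC.
Qed.

Lemma geometric_correction_cvg :
  e m *: (Y m * \sum_(j < N m) (1 - Y m ^+ 2) ^+ j) @[m --> \oo]
    --> (0 : 'M[R]_d.+1).
Proof.
apply: (@cvg0_of_le _ (a * expR (a ^+ 2))) => m.
rewrite normrZ ger0_norm// (le_trans (ler_wpM2l _ (mx_norm_mul _ _)))//.
rewrite normY.
rewrite (le_trans (ler_wpM2l _ (ler_wpM2l _ (mx_norm_sum_expr1D (normY2N m)))))//.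
  by rewrite mulr_ge0.
set E := expR _; have E0 : 0 <= E by exact: expR_ge0.
have -> : e m * (e m * a * ((N m)%:R * E)) = ((N m)%:R * e m) * (a * E * e m).
  by ring.
by rewrite ler_piMl ?mulr_ge0.
Qed.

Let pow_cvg1 : (1 - Y m ^+ 2) ^+ m.*2 @[m --> \oo] --> (1 : 'M[R]_d.+1).
Proof.
apply/subr_cvg0; apply: (@cvg0_of_le _ (a ^+ 2 * expR (a ^+ 2))) => m.
rewrite subrX1 (le_trans (mx_norm_mul _ _))// addrAC subrr add0r.
have nN : (m.*2%:R : R) * (d.+1%:R * `|- (Y m ^+ 2)|) <= a ^+ 2.
  by rewrite (le_trans _ (normY2N m))// ler_wpM2r// ?mulr_ge0// ler_nat.
rewrite (le_trans (ler_pM _ _ (normY2 m) (mx_norm_sum_expr1D nN)))// ?mulr_ge0//.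
set E := expR _; have E0 : 0 <= E by exact: expR_ge0.
have -> : e m ^+ 2 * a ^+ 2 * (m.*2%:R * E) = (m.*2%:R * e m) * (a ^+ 2 * E * e m).
  by ring.
rewrite ler_piMl ?mulr_ge0 ?exprn_ge0// (le_trans _ (eN_le1 m))//.
by rewrite ler_wpM2r// ler_nat.
Qed.

Let tail_cvg0 :
  (1 + Y m) ^+ N m * (1 + Y m) ^+ m.*2 * Y m @[m --> \oo] --> (0 : 'M[R]_d.+1).
Proof.
have nN m : ((N m)%:R : R) * (d.+1%:R * `|Y m|) <= a.
  by rewrite normY mulrA ler_piMl.
pose D : R := d.+1%:R.
apply: (@cvg0_of_le _ (D * (D * expR a * expR a) * `|A|)) => m.
rewrite (le_trans (mx_norm_mul _ _))// [`|Y m|]normrZ ger0_norm// -[leRHS]mulrA.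
rewrite [e m * _]mulrC ler_wpM2r ?mulr_ge0// ler_wpM2l//.
rewrite (le_trans (mx_norm_mul _ _))// -!mulrA ler_wpM2l// ler_pM//.
  exact: mx_norm_expr1D (nN m) _.
exact: mx_norm_expr1D (nN m) _.
Qed.

(** Since Y has order 1 / N, the power (1 - Y^2)^(2m) tends to 1, and the powers
    of 1 + Y stay bounded. *)
Lemma finite_rhs_cvg :
  (1 - Y m ^+ 2) ^+ m.*2 * (1 + Y m) * (1 - 2^-1 *: Y m)
    - 2^-1 *: ((1 + Y m) ^+ N m * (1 + Y m) ^+ m.*2 * Y m) @[m --> \oo]
  --> (1 : 'M[R]_d.+1).
Proof.
have limE : (1 : 'M[R]_d.+1) = 1 * (1 + 0) * (1 - 2^-1 *: 0) - 2^-1 *: 0.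
  by rewrite !scaler0 !subr0 addr0 !mulr1.
rewrite [X in _ --> X]limE.
apply: cvgB.
  apply: cvg_mulmx.
    apply: cvg_mulmx; first exact: pow_cvg1.
    by apply: cvgD; [exact: cvg_cst|exact: Y_cvg0].
  apply: cvgB; first exact: cvg_cst.
  by apply: cvgZ; [exact: cvg_cst|exact: Y_cvg0].
by apply: cvgZ; [exact: cvg_cst|exact: tail_cvg0].
Qed.

End vanishing_corrections.

(** * The partial fractions of psi1 *)

(** For large c the matrix A^2 + c is a small perturbation of c. *)
Lemma lorentz_mx_large (R : realFieldType) (d : nat) (A : 'M[R]_d) (c : R) :
  0 < c -> 2 * (d%:R * `|A ^+ 2|) <= c ->
  (A ^+ 2 + c%:M \in unitmx) * (`|lorentz_mx A c| <= d%:R * `|A ^+ 2| * (2 / c)).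
Proof.
move=> c0 cA.
have uc : c%:M \in @unitmx R d by rewrite unitmxE det_scalar unitrX// unitfE gt_eqF.
have invE : invmx (c%:M : 'M[R]_d) = c^-1%:M by rewrite invmx_scalar.
have := @invmx_perturb R d c%:M (A ^+ 2) uc.
rewrite addrC invE mul_scalar_mx normrZ ger0_norm ?invr_ge0 ?(ltW c0)//.
case=> [|u le].
  by rewrite mulrCA mulrC ler_pdivrMr//; move: cA; set D := _ * `|_|; lra.
split=> //; rewrite (le_trans (mx_norm_mul _ _))// ler_wpM2l ?mulr_ge0//.
rewrite (le_trans le)// ler_pM2l// (le_trans (mx_norm_scalar _ _))//.
by rewrite ger0_norm ?invr_ge0 ?(ltW c0).
Qed.

Lemma lorentz_mx_cvg (R : realFieldType) (d : nat) (A : 'M[R]_d) (T : Type)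
    (F : set_system T) (FF : Filter F) (c : T -> R) (l : R) :
  A ^+ 2 + l%:M \in unitmx -> c @ F --> l ->
  (\forall t \near F, A ^+ 2 + (c t)%:M \in unitmx) /\
  (fun t => lorentz_mx A (c t)) @ F --> lorentz_mx A l.
Proof.
move=> ul cl.
have Mc : (fun t => A ^+ 2 + (c t)%:M) @ F --> A ^+ 2 + l%:M.
  apply: cvgD; first exact: cvg_cst.
  rewrite -scalemx1 (_ : (fun t => (c t)%:M) = (fun t => c t *: 1%:M)).
    by apply: cvgZ => //; exact: cvg_cst.
  by apply/funext => t; rewrite scalemx1.
have [near_u inv_cvg] := invmx_cvg FF ul Mc.
by split=> //; apply: cvg_mulmx => //; exact: cvg_cst.
Qed.

(** Only for finitely many k can A^2 + c fail to be a small perturbation of c with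
    c at least (2 pi (k + 1))^2.  For those k the invertibility of the limit
    passes to large m by continuity; for the other k the norms are O(1 / k^2)
    uniformly in m. *)
Lemma lorentz_sum_cvg (R : realType) (d : nat) (A : 'M[R]_d) :
  (forall k, A ^+ 2 + ((2 * pi * k.+1%:R) ^+ 2)%:M \in unitmx) ->
  let g k := lorentz_mx A ((2 * pi * k.+1%:R) ^+ 2) in
  [/\ \forall m \near \oo, forall k, (k < m)%N ->
        A ^+ 2 + (tan_node R m k ^+ 2)%:M \in unitmx,
      cvgn (series g) &
      \sum_(0 <= k < m) lorentz_mx A (tan_node R m k ^+ 2) @[m --> \oo]
        --> limn (series g)].
Proof.
move=> uA g.
pose D : R := d%:R * `|A ^+ 2|; have D0 : 0 <= D by rewrite mulr_ge0.
have [K DK] : exists K : nat, 2 * D <= K%:R.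
  exists (Num.bound (2 * D)); rewrite ltW// archi_boundP// mulr_ge0//.
(* The first summand bounds the terms with k >= K, the sum the terms with
   k < K, which are eventually below |g k| + 1. *)
pose C : R := 2 * D + \sum_(k < K) (`|g k| + 1) * k.+1%:R ^+ 2.
pose b k : R := C * (k.+1%:R ^+ 2)^-1.
have terms0 (k : 'I_K) : 0 <= (`|g k| + 1) * k.+1%:R ^+ 2.
  by rewrite mulr_ge0 ?exprn_ge0// addr_ge0.
have C2D : 2 * D <= C by rewrite lerDl sumr_ge0.
have bsmall k x : (k < K)%N -> x <= `|g k| + 1 -> x <= b k.
  move=> kK xg; rewrite (le_trans xg)// /b ler_pdivlMr ?exprn_gt0//.
  rewrite /C (bigD1 (Ordinal kK))//= addrCA lerDl addr_ge0 ?mulr_ge0//.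
  by rewrite sumr_ge0.
have blarge k c : (K <= k)%N -> 2 * pi * k.+1%:R <= c ->
    (A ^+ 2 + (c ^+ 2)%:M \in unitmx) * (`|lorentz_mx A (c ^+ 2)| <= b k).
  move=> Kk kc.
  have k1 : 1 <= k.+1%:R :> R by rewrite ler1n.
  have kc1 : k.+1%:R <= c.
    rewrite (le_trans _ kc)// ler_peMl//; have := pi_ge2 R; lra.
  have c0 : 0 < c by rewrite (lt_le_trans _ kc1).
  have kc2 : k.+1%:R ^+ 2 <= c ^+ 2.
    by rewrite ler_pXn2r// nnegrE ltW.
  have Dc : 2 * D <= c ^+ 2.
    rewrite (le_trans DK)// (le_trans _ kc2)// (@le_trans _ _ k.+1%:R)//.
      by rewrite ler_nat ltnW.
    by rewrite expr2 ler_peMl.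
  have [u n] := lorentz_mx_large (exprn_gt0 2 c0) Dc.
  split=> //; rewrite (le_trans n)// /b mulrA ler_pM// ?invr_ge0 ?exprn_ge0 ?mulr_ge0//.
  - exact: ltW.
  - by rewrite mulrC.
  - by rewrite lef_pV2 ?posrE ?exprn_gt0.
have node_sq_cvg k : tan_node R m k ^+ 2 @[m --> \oo] --> (2 * pi * k.+1%:R) ^+ 2.
  rewrite !expr2; apply: cvgM; exact: tan_node_cvg.
have gb k : `|g k| <= b k.
  have [kK|Kk] := ltnP k K; first by apply: bsmall => //; rewrite lerDl.
  by have [] := blarge k _ Kk (lexx _).
have cb : cvgn (series b).
  by apply: is_cvg_seriesZ; exact: cvg_series_invsq.
have head : \forall m \near \oo, forall k : 'I_K,
    (A ^+ 2 + (tan_node R m k ^+ 2)%:M \in unitmx) /\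
    `|lorentz_mx A (tan_node R m k ^+ 2)| <= b k.
  apply: filter_forall => k.
  have [u l] := lorentz_mx_cvg _ (uA k) (node_sq_cvg k).
  have /cvgrPdist_le /(_ _ ltr01) := l.
  apply: filterS2 u => m u le; split=> //; apply: bsmall => //.
  rewrite -(subrK (g k) (lorentz_mx _ _)) addrC (le_trans (ler_normD _ _))//.
  by rewrite lerD2l distrC.
have near_all : \forall m \near \oo, forall k, (k < m)%N ->
    (A ^+ 2 + (tan_node R m k ^+ 2)%:M \in unitmx) /\
    `|lorentz_mx A (tan_node R m k ^+ 2)| <= b k.
  apply: filterS head => m hm k km.
  have [kK|Kk] := ltnP k K; first exact: hm (Ordinal kK).
  by have [] := blarge k _ Kk (tan_node_ge R km).
have cg : cvgn (series g) by apply: cvg_series_dominated gb cb.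
split=> //.
  by apply: filterS near_all => m hm k km; case: (hm k km).
apply: (@tannery _ _ _ _ b) => //.
- by apply: filterS near_all => m hm k km; case: (hm k km).
- by move=> k; rewrite (le_trans _ (gb k)).
- by move=> k; case: (lorentz_mx_cvg _ (uA k) (node_sq_cvg k)).
Qed.

Theorem phi1_mx_partial_fractions (R : realType) (d : nat) (A : 'M[R]_d.+1) :
  (forall k, A ^+ 2 + ((2 * pi * k.+1%:R) ^+ 2)%:M \in unitmx) ->
  phi1_mx A * (1 - 2^-1 *: A
    + 2 *: limn (series (fun k => lorentz_mx A ((2 * pi * k.+1%:R) ^+ 2)))) = 1.
Proof.
move=> uA; have [near_u cg lim_g] := lorentz_sum_cvg uA.
set L := limn _ in lim_g *.
have sub_oo : (fun m => m.*2.+1.*2) @ \oo --> \oo.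
  move=> S [n _ nS]; exists n => // m /= nm; apply: nS => /=.
  by rewrite (leq_trans nm)// -!addnn -addSn -addnA (leq_trans _ (leq_addr _ _)).
pose P m := \sum_(0 <= j < m.*2.+1.*2)
    ('C(m.*2.+1.*2, j.+1)%:R / m.*2.+1.*2%:R ^+ j.+1) *: A ^+ j
  + m.*2.+1.*2%:R^-1 *: (m.*2.+1.*2%:R^-1 *: A
      * \sum_(j < m.*2.+1) (1 - (m.*2.+1.*2%:R^-1 *: A) ^+ 2) ^+ j).
pose Q m := 1 - 2^-1 *: A
  + 2 *: \sum_(0 <= k < m) lorentz_mx A (tan_node R m k ^+ 2).
have P_cvg : P @ \oo --> phi1_mx A.
  rewrite -[X in _ --> X]addr0; apply: cvgD.
    exact: (cvg_comp _ _ sub_oo (phi1_mx_cvg A).2).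
  exact: geometric_correction_cvg.
have Q_cvg : Q @ \oo --> 1 - 2^-1 *: A + 2 *: L.
  by apply: cvgD; [exact: cvg_cst|apply: cvgZ => //; exact: cvg_cst].
have PQ_cvg : (fun m => P m * Q m) @ \oo --> phi1_mx A * (1 - 2^-1 *: A + 2 *: L).
  exact: cvg_mulmx P_cvg Q_cvg.
apply: (cvg_unique _ PQ_cvg); first exact: norm_hausdorff.
apply: cvg_trans (finite_rhs_cvg A); apply: near_eq_cvg.
by apply: filterS near_u => m um; rewrite -(finite_partial_fractions um).
Qed.

(** * Geometric expansion of the partial fractions *)

Definition even_zeta (R : realType) (n : nat) : R :=
  limn (series (fun k => (k.+1%:R ^+ (2 * n.+1))^-1 : R)).

Lemma even_zeta_cvg (R : realType) (n : nat) :
  cvgn (series (fun k => (k.+1%:R ^+ (2 * n.+1))^-1 : R)).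
Proof.
apply: (@series_le_cvg R _ (fun k => (k.+1%:R ^+ 2)^-1)) => [k|k|k|].
- by rewrite invr_ge0 exprn_ge0.
- by rewrite invr_ge0 exprn_ge0.
- rewrite lef_pV2 ?posrE ?exprn_gt0// ler_weXn2l ?ler1n//.
  by rewrite -{1}[2%N]muln1 leq_mul2l.
exact: cvg_series_invsq.
Qed.

(** One step of the geometric expansion: with a = A / 2 pi,
    a^2 (a^2 + k^2)^-1 = 1 - k^2 (a^2 + k^2)^-1. *)
Lemma psi1_termS (R : realType) (n d : nat) (A : 'M[R]_d) (k : nat) :
  (0 < k)%N -> shifted_square A k \in unitmx ->
  psi1_term n A k =
  (k%:R ^+ (2 * n.+1))^-1 *: ((2 * pi)^-1 *: A) ^+ (2 * n.+1)
  - psi1_term n.+1 A k.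
Proof.
move=> k0 uk; rewrite /psi1_term; set a := _ *: A.
have kn0 : k%:R != 0 :> R by rewrite pnatr_eq0 -lt0n.
have -> : a ^+ (2 * n.+2) = a ^+ (2 * n.+1) *m a ^+ 2.
  by rewrite (mulnS 2 n.+1) addnC exprD.
have aI : a ^+ 2 *m invmx (shifted_square A k)
    = 1%:M - k%:R ^+ 2 *: invmx (shifted_square A k).
  rewrite (_ : a ^+ 2 = shifted_square A k - (k%:R ^+ 2)%:M).
    by rewrite mulmxBl mulmxV// mul_scalar_mx.
  by rewrite /shifted_square addrK.
rewrite -[X in _ - _ *: X]mulmxA aI mulmxBr mulmx1 -[in RHS]scalemxAr.
rewrite scalerBr scalerA opprB addrC subrK; congr (_ *: _).
by rewrite mulnS addnC exprD invfM mulfVK// expf_neq0.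
Qed.

Lemma psi1_term0 (R : realType) (d : nat) (A : 'M[R]_d.+1) (k : nat) :
  shifted_square A k \in unitmx ->
  (A ^+ 2 + ((2 * pi * k%:R) ^+ 2)%:M \in unitmx) *
  (lorentz_mx A ((2 * pi * k%:R) ^+ 2) = psi1_term 0 A k).
Proof.
move=> uk.
have p0 : (2 * pi) ^+ 2 != 0 :> R by rewrite expf_neq0// mulf_neq0// gt_eqF ?pi_gt0.
have E : A ^+ 2 + ((2 * pi * k%:R) ^+ 2)%:M = (2 * pi) ^+ 2 *: shifted_square A k.
  rewrite /shifted_square scalerDr [(_ *: A) ^+ _]exprZn scalerA exprVn mulfV// scale1r.
  by rewrite scale_scalar_mx -exprMn.
have uE : A ^+ 2 + ((2 * pi * k%:R) ^+ 2)%:M \in unitmx.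
  by rewrite E unitmxZ ?unitfE.
split=> //; rewrite /lorentz_mx /psi1_term muln0 expr0 invr1 scale1r muln1.
by rewrite E invmxZ -?E// [(_ *: A) ^+ _]exprZn -scalemxAr -scalemxAl exprVn.
Qed.

Lemma psi1_series_cvg (R : realType) (d : nat) (A : 'M[R]_d.+1) (n : nat) :
  (forall k, (0 < k)%N -> shifted_square A k \in unitmx) ->
  let a := (2 * pi)^-1 *: A in
  let L n := limn (series (fun k => psi1_term n A k.+1)) in
  cvgn (series (fun k => psi1_term n A k.+1)) /\
  L n = even_zeta R n *: a ^+ (2 * n.+1) - L n.+1.
Proof.
move=> uA a L.
have zeta_cvg m : series (fun k => (k.+1%:R ^+ (2 * m.+1))^-1 *: a ^+ (2 * m.+1))
    @ \oo --> even_zeta R m *: a ^+ (2 * m.+1).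
  rewrite (_ : series _ = fun n =>
      series (fun k => (k.+1%:R ^+ (2 * m.+1))^-1) n *: a ^+ (2 * m.+1)).
    by apply: cvgZ; [exact: even_zeta_cvg|exact: cvg_cst].
  by apply/funext => j; rewrite /series/= scaler_suml.
have stepE m : (fun k => psi1_term m.+1 A k.+1) =
    (fun k => (k.+1%:R ^+ (2 * m.+1))^-1 *: a ^+ (2 * m.+1))
    - (fun k => psi1_term m A k.+1).
  apply/funext => k; rewrite !fctE (@psi1_termS _ m) ?uA//.
  by rewrite opprB addrC subrK.
have step_cvg m : cvgn (series (fun k => psi1_term m A k.+1)) ->
    series (fun k => psi1_term m.+1 A k.+1) @ \oo -->
      even_zeta R m *: a ^+ (2 * m.+1) - L m.
  by move=> cm; rewrite stepE seriesD seriesN; apply: cvgB (zeta_cvg m) cm.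
have cvg_all m : cvgn (series (fun k => psi1_term m A k.+1)).
  elim: m => [|m ih]; last by apply/cvg_ex; eexists; exact: step_cvg.
  have [|_ + _] := @lorentz_sum_cvg R d.+1 A.
    by move=> k; case: (psi1_term0 (uA k.+1 isT)).
  rewrite (_ : (fun k => lorentz_mx _ _) = (fun k => psi1_term 0 A k.+1))//.
  by apply/funext => k; case: (psi1_term0 (uA k.+1 isT)).
split=> //; rewrite {2}/L (cvg_lim (@norm_hausdorff _ _) (step_cvg _ (cvg_all n))).
by rewrite opprB addrC subrK.
Qed.

(** The number B_(2i+2) / (2i+2)! in terms of zeta (2i+2), by Euler's formula,
    which [bernoulli_number_coef] proves. *)
Definition bernoulli_coef (R : realType) (i : nat) : R :=
  2 * (-1) ^+ i * even_zeta R i / (2 * pi) ^+ (2 * i.+1).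

Theorem psi1_mx_expansion (R : realType) (d : nat) (A : 'M[R]_d.+1) (n : nat) :
  (forall k, (0 < k)%N -> shifted_square A k \in unitmx) ->
  phi1_mx A \in unitmx /\
  psi1_mx A = 1%:M - 2^-1 *: A
    + \sum_(0 <= i < n) bernoulli_coef R i *: A ^+ (2 * i.+1)
    + (2 * (-1) ^+ n) *: limn (series (fun k => psi1_term n A k.+1)).
Proof.
move=> uA; set L := limn _.
have expand : 2 *: limn (series (fun k => psi1_term 0 A k.+1)) =
    \sum_(0 <= i < n) bernoulli_coef R i *: A ^+ (2 * i.+1)
    + (2 * (-1) ^+ n) *: L.
  rewrite /L; elim: n {L} => [|n ih]; first by rewrite big_geq// add0r mulr1.
  rewrite ih big_nat_recr//= -addrA; congr (_ + _).
  rewrite (psi1_series_cvg n uA).2 scalerBr exprSr mulrA mulrN1 scaleNr.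
  congr (_ - _); rewrite [(_ *: A) ^+ _]exprZn !scalerA; congr (_ *: _).
  by rewrite /bernoulli_coef exprVn.
have := @phi1_mx_partial_fractions R d A.
rewrite (_ : (fun k => lorentz_mx _ _) = (fun k => psi1_term 0 A k.+1)); last first.
  by apply/funext => k; case: (psi1_term0 (uA k.+1 isT)).
rewrite expand addrA => /(_ (fun k => (psi1_term0 (uA k.+1 isT)).1)) phi_inv.
have uphi : phi1_mx A \in unitmx by have [] := mulmx1_unit phi_inv.
split=> //; rewrite /psi1_mx; apply: (can_inj (mulKmx uphi)).
by rewrite mulmxV// -[LHS]phi_inv.
Qed.

(** * The scalar case *)

Lemma phi1_mx_scalar (R : realType) (d : nat) (x : R) : x != 0 ->
  phi1_mx (x%:M : 'M[R]_d.+1) = ((expR x - 1) / x)%:M.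
Proof.
move=> x0; apply: cvg_lim; first exact: norm_hausdorff.
have -> : series (fun k => k.+1`!%:R^-1 *: (x%:M : 'M[R]_d.+1) ^+ k) =
    fun n => ((series (exp_coeff x) n.+1 - 1) / x) *: 1%:M.
  apply/funext => n; rewrite /series/= big_nat_recl// /exp_coeff/= expr0 fact0.
  rewrite divr1 addrAC subrr add0r mulr_suml scaler_suml; apply: eq_bigr => k _.
  rewrite -(rmorphXn (scalar_mx : {rmorphism R -> 'M[R]_d.+1}))/=.
  rewrite !scale_scalar_mx mulr1; congr (_%:M).
  by rewrite exprSr mulrAC mulfK// mulrC.
rewrite -[X in _ --> X]scalemx1; apply: cvgZ; last exact: cvg_cst.
apply: cvgM; last exact: cvg_cst; apply: cvgB; last exact: cvg_cst.
by rewrite (cvg_shiftS (series (exp_coeff x))); exact: is_cvg_series_exp_coeff.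
Qed.

Lemma shifted_square_scalar (R : realType) (d : nat) (x : R) (k : nat) :
  shifted_square (x%:M : 'M[R]_d.+1) k = (((2 * pi)^-1 * x) ^+ 2 + k%:R ^+ 2)%:M.
Proof.
rewrite /shifted_square scale_scalar_mx.
by rewrite -(rmorphXn (scalar_mx : {rmorphism R -> 'M[R]_d.+1}))/= -raddfD.
Qed.

Lemma psi1_term_scalar_le (R : realType) (d : nat) (x : R) (n k : nat) : 0 < x ->
  `|psi1_term n (x%:M : 'M[R]_d.+1) k.+1| <= x ^+ (2 * n.+1) * (k.+1%:R ^+ 2)^-1.
Proof.
move=> x0; rewrite /psi1_term shifted_square_scalar invmx_scalar scale_scalar_mx.
rewrite -(rmorphXn (scalar_mx : {rmorphism R -> 'M[R]_d.+1}))/=.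
rewrite -scalar_mxM scale_scalar_mx; set t := _^-1 * x.
have p2 : 1 <= 2 * pi :> R by have := pi_ge2 R; lra.
have t0 : 0 < t by rewrite mulr_gt0// invr_gt0 (lt_le_trans _ p2).
have tx : t <= x by rewrite ler_piMl ?(ltW x0)// invf_le1// (lt_le_trans _ p2).
have k0 : 0 < k.+1%:R ^+ 2 :> R by rewrite exprn_gt0.
rewrite (le_trans (mx_norm_scalar _ _))// ger0_norm; last first.
  by rewrite !mulr_ge0 ?invr_ge0 ?addr_ge0 ?exprn_ge0 ?(ltW t0).
rewrite -[leRHS]mul1r ler_pM ?mulr_ge0 ?invr_ge0 ?addr_ge0 ?exprn_ge0 ?(ltW t0)//.
  by rewrite invf_le1 ?exprn_gt0// exprn_ege1// ler1n.
rewrite ler_pM ?invr_ge0 ?addr_ge0 ?exprn_ge0 ?(ltW t0)//.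
  by rewrite lerXn2r// nnegrE ltW.
by rewrite lef_pV2 ?posrE ?addr_gt0 ?exprn_gt0// lerDr exprn_ge0// ltW.
Qed.

(** The scalar case of [psi1_mx_expansion], for 1 x 1 matrices; the remainder has
    order x^(2n+2) since 1 / k^2 dominates its terms divided by this power. *)
Lemma psi1_asymptotic (R : realType) (n : nat) :
  exists2 C : R, 0 <= C & forall x : R, 0 < x ->
  `|x / (expR x - 1) - (1 - 2^-1 * x
     + \sum_(0 <= i < n) bernoulli_coef R i * x ^+ (2 * i.+1))|
    <= C * x ^+ (2 * n.+1).
Proof.
pose Z : R := limn (series (fun k => (k.+1%:R ^+ 2)^-1 : R)).
have Z_ge m : series (fun k => (k.+1%:R ^+ 2)^-1 : R) m <= Z.
  apply: nondecreasing_cvgn_le; last exact: cvg_series_invsq.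
  by apply: nondecreasing_series => k _ _; rewrite invr_ge0 exprn_ge0.
exists (2 * Z) => [|x x0].
  by rewrite mulr_ge0// (le_trans _ (Z_ge 0))// /series/= big_geq.
pose X : 'M[R]_1 := x%:M.
have uX k : (0 < k)%N -> shifted_square X k \in unitmx.
  move=> k0; rewrite shifted_square_scalar unitmxE det_scalar unitrX// unitfE.
  have t0 : 0 <= (2 * pi)^-1 * x.
    by rewrite mulr_ge0 ?(ltW x0)// invr_ge0 mulr_ge0// pi_ge0.
  by rewrite gt_eqF// addrC ltr_wpDr ?exprn_ge0// exprn_gt0// ltr0n.
have [_] := psi1_mx_expansion n uX.
set L := limn _ => expansion.
have ex1 : expR x - 1 != 0 by rewrite subr_eq0 gt_eqF// expR_gt1.
have := congr1 (fun M : 'M[R]_1 => M 0 0) expansion.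
rewrite /psi1_mx phi1_mx_scalar ?gt_eqF// invmx_scalar invf_div.
have sum_entry : (\sum_(0 <= i < n) bernoulli_coef R i *: X ^+ (2 * i.+1)) 0 0 =
    \sum_(0 <= i < n) bernoulli_coef R i * x ^+ (2 * i.+1).
  rewrite summxE; apply: eq_bigr => i _.
  by rewrite -(rmorphXn (scalar_mx : {rmorphism R -> 'M[R]_1}))/= !mxE mulr1n.
rewrite !mxE sum_entry !mulr1n => ->; rewrite [X in `|X - _|]addrC addrK.
rewrite normrM normrM normr_nat normrX normrN1 expr1n mulr1 -mulrA ler_pM2l//.
have Lle : `|L| <= Z * x ^+ (2 * n.+1).
  have Lcvg : (fun m => `|series (fun k => psi1_term n X k.+1) m|) @ \oo --> `|L|.
    by apply: cvg_norm; exact: (psi1_series_cvg n uX).1.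
  apply: (cvgr_to_le Lcvg); near=> m.
  rewrite (le_trans (ler_norm_sum _ _ _))//.
  rewrite (@le_trans _ _ (\sum_(0 <= k < m) x ^+ (2 * n.+1) * (k.+1%:R ^+ 2)^-1))//.
    by apply: ler_sum => k _; apply: psi1_term_scalar_le.
  by rewrite -mulr_sumr mulrC ler_wpM2r ?exprn_ge0 ?(ltW x0)// Z_ge.
apply: le_trans Lle; rewrite -[`|L|]/(mx_norm _) mx_normrE.
exact: (le_bigmax _ (fun ij => `|L ij.1 ij.2|) (0, 0)).
Unshelve. all: by end_near. Qed.

(** * Uniqueness of the coefficients *)

Lemma geometric_half_sum_le (R : realFieldType) (q : R) (m n : nat) :
  0 <= q <= 2^-1 -> \sum_(m <= j < n) q ^+ j <= 2 * q ^+ m.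
Proof.
move=> /andP[q0 q2]; have [mn|nm] := leqP m n; last first.
  by rewrite big_geq ?(ltnW nm)// mulr_ge0// exprn_ge0.
rewrite -{1}[m]add0n big_addn mulrC.
rewrite (eq_bigr (fun j => q ^+ m * q ^+ j)) => [|j _]; last first.
  by rewrite addnC exprD.
rewrite -mulr_sumr ler_wpM2l ?exprn_ge0// big_mkord.
have := subrX1 q (n - m); set S := \sum_(_ < _) _ => SE.
have S0 : 0 <= S by apply: sumr_ge0 => i _; rewrite exprn_ge0.
have qn : 0 <= q ^+ (n - m) by rewrite exprn_ge0.
have : q * S <= 2^-1 * S by rewrite ler_wpM2r.
by move: SE; rewrite mulrBl mul1r => *; lra.
Qed.

(** By induction on k the terms before the k-th vanish, and those after it are
    O(x^(k+1)), as is s; hence a k = O(x). *)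
Lemma power_series_coef_eq0 (R : realType) (a : nat -> R) (s : R -> R)
    (r C : R) (M : nat) :
  0 < r ->
  (forall x, 0 < x < r -> series (fun k => a k * x ^+ k) @ \oo --> s x) ->
  (forall x, 0 < x < r -> `|s x| <= C * x ^+ M) ->
  forall k, (k < M)%N -> a k = 0.
Proof.
move=> r0 a_cvg s_le; elim/ltn_ind => k ih kM.
pose h := r / 2; have h0 : 0 < h by rewrite divr_gt0.
have hr : h < r by rewrite /h; lra.
have [b b0 ab] : exists2 b, 0 <= b & forall j, `|a j| <= b * h^-1 ^+ j.
  have /cvg_series_bounded : cvgn (series (fun k => a k * h ^+ k)).
    by apply/cvg_ex; eexists; apply: a_cvg; rewrite h0.
  move=> [b [breal bP]]; exists (`|b| + 1) => [|j]; first by rewrite addr_ge0.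
  have := bP (`|b| + 1); rewrite (le_lt_trans (ler_norm b)) ?ltrDl// => /(_ isT j I).
  by rewrite /= normrM [`|h ^+ j|]ger0_norm ?exprn_ge0 ?(ltW h0)//
    exprVn ler_pdivlMr ?exprn_gt0.
(* The two summands come from s and from the tail after the k-th term; the
   factor 2 is the sum of the geometric series of ratio x / h <= 1 / 2. *)
pose K := `|C| + b * (2 * h^-1 ^+ k.+1).
have K0 : 0 <= K by rewrite addr_ge0 ?mulr_ge0 ?exprn_ge0 ?invr_ge0 ?(ltW h0).
have key x : 0 < x -> x <= h / 2 -> x <= 1 -> `|a k| <= K * x.
  move=> x0 xh x1.
  have xr : 0 < x < r by rewrite x0 (le_lt_trans xh)//; move: hr h0; lra.
  pose q := x / h.
  have q01 : 0 <= q <= 2^-1.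
    by rewrite divr_ge0 ?(ltW x0) ?(ltW h0)//= ler_pdivrMr// mulrC.
  suff : `|a k| * x ^+ k <= K * x ^+ k.+1.
    by rewrite exprS mulrA ler_pM2r ?exprn_gt0.
  have -> : K * x ^+ k.+1 = `|C| * x ^+ k.+1 + b * (2 * q ^+ k.+1).
    by rewrite /K /q exprMn mulrDl -!mulrA [x ^+ _ * _]mulrC.
  have sn_cvg : `|series (fun k => a k * x ^+ k) n| + b * (2 * q ^+ k.+1)
      @[n --> \oo] --> `|s x| + b * (2 * q ^+ k.+1).
    by apply: cvgD; [apply: cvg_norm; exact: a_cvg|exact: cvg_cst].
  apply: (@le_trans _ _ (`|s x| + b * (2 * q ^+ k.+1))); last first.
    rewrite lerD2r (le_trans (s_le x xr))//.
    rewrite (@le_trans _ _ (`|C| * x ^+ M))//.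
      by rewrite ler_wpM2r ?ler_norm// exprn_ge0// ltW.
    by rewrite ler_wpM2l// ler_wiXn2l// ltW.
  apply: (cvgr_to_ge sn_cvg); near=> n.
  have kn : (k < n)%N by near: n; exact: nbhs_infty_gt.
  rewrite -{1}(ger0_norm (exprn_ge0 k (ltW x0))) -normrM -lerBlDr.
  have -> : series (fun k => a k * x ^+ k) n =
      a k * x ^+ k + \sum_(k.+1 <= j < n) a j * x ^+ j.
    rewrite /series/= (big_cat_nat (n := k))//=; last exact: ltnW.
    rewrite big_nat big1 ?add0r => [|j /andP[_ jk]]; last first.
      by rewrite ih ?mul0r// (ltn_trans jk).
    by rewrite big_ltn.
  set T := \sum_(_ <= _ < _) _.
  have T_le : `|T| <= b * (2 * q ^+ k.+1).
    rewrite (le_trans (ler_norm_sum _ _ _))//.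
    apply: le_trans (ler_wpM2l b0 (geometric_half_sum_le k.+1 n q01)).
    rewrite mulr_sumr; apply: ler_sum => j _.
    rewrite normrM [`|x ^+ j|]ger0_norm ?exprn_ge0 ?(ltW x0)// /q exprMn.
    by rewrite [x ^+ j * _]mulrC mulrA ler_wpM2r ?exprn_ge0 ?(ltW x0).
  rewrite (le_trans (lerB (lexx _) T_le))// lerBlDr.
  by rewrite -{1}(addrK T (a k * _)) (le_trans (ler_normB _ _)).
apply/eqP; rewrite -normr_le0 leNgt; apply/negP => ak0.
pose x := Num.min (Num.min (h / 2) 1) (`|a k| / (2 * (K + 1))).
have K1 : 0 < K + 1 by lra.
have x0 : 0 < x.
  by rewrite /x !lt_min ltr01 andbT; apply/andP; split;
    apply: divr_gt0 => //; rewrite mulr_gt0.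
have xh : x <= h / 2 by rewrite !ge_min lexx.
have x1 : x <= 1 by rewrite !ge_min lexx orbT.
have := key x x0 xh x1; apply/negP; rewrite -ltNge.
have : x <= `|a k| / (2 * (K + 1)) by rewrite ge_min lexx orbT.
rewrite ler_pdivlMr ?mulr_gt0// => xa.
rewrite (lt_le_trans _ xa)// [2 * _]mulrDr mulr1 mulrDr.
have : 0 <= x * K by rewrite mulr_ge0 ?(ltW x0).
by rewrite [K * x]mulrC; nra.
Unshelve. all: by end_near. Qed.

Lemma bernoulli_numbers_real (R : realType) (B : nat -> R) (x : R) :
  bernoulli_numbers B -> 0 < x < 2 * pi ->
  series (fun k => B k / k`!%:R * x ^+ k) @ \oo --> x / (expR x - 1).
Proof.
move=> hB /andP[x0 xpi].
have norm_real (y : R) : `|y%:C| = `|y|%:C.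
  by rewrite normc_def/= expr0n/= addr0 sqrtr_sqr.
have psiE : psi1 x%:C = (x / (expR x - 1))%:C.
  rewrite /psi1 -[0]/(0%:C) (inj_eq (@complexI R)) gt_eqF//.
  by rewrite /cexp/= cos0 sin0 -[1 +i* 0]/(1%:C) mulr1 -rmorphB/= -fmorph_div.
have zlt : `|x%:C| < (2 * pi)%:C by rewrite norm_real ltcR ger0_norm ?ltW.
have := hB x%:C zlt; rewrite psiE => /cvgrPdist_lt cB.
apply/cvgrPdist_lt => e e0.
have ec0 : 0 < e%:C by rewrite -[0]/(0%:C) ltcR.
apply: filterS (cB _ ec0) => n.
have -> : series (fun k => (B k)%:C * (x%:C ^+ k / k`!%:R) : R[i]^o) n =
    (series (fun k => B k / k`!%:R * x ^+ k) n)%:C.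
  rewrite /series/= rmorph_sum/=; apply: eq_bigr => k _.
  rewrite !rmorphM/= fmorphV rmorph_nat rmorphXn/=.
  by rewrite mulrA mulrAC.
by rewrite -rmorphB/= norm_real ltcR.
Qed.

(** Along the positive reals the generating series of B differs from the
    polynomial part of [psi1_asymptotic] by O(x^(2i+4)), so that the coefficients
    of lower order agree. *)
Lemma bernoulli_number_coef (R : realType) (B : nat -> R) (i : nat) :
  bernoulli_numbers B -> B (2 * i.+1)%N / (2 * i.+1)`!%:R = bernoulli_coef R i.
Proof.
move=> hB; have [C _ CP] := psi1_asymptotic R i.+1.
pose p : {poly R} := 1 - 2^-1 *: 'X
  + \sum_(0 <= j < i.+1) bernoulli_coef R j *: 'X^(2 * j.+1).
have pE x : p.[x] = 1 - 2^-1 * x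
    + \sum_(0 <= j < i.+1) bernoulli_coef R j * x ^+ (2 * j.+1).
  rewrite /p !hornerE horner_sum; congr (_ + _); apply: eq_bigr => j _.
  by rewrite !hornerE.
have p_coef : p`_(2 * i.+1) = bernoulli_coef R i.
  rewrite /p !coefD coefN coefZ coef1 coefX coef_sum big_nat_recr//=.
  rewrite big_nat big1 => [|j /andP[_ ji]]; last first.
    by rewrite coefZ coefXn eqn_mul2l/= eqSS gtn_eqF// mulr0.
  by rewrite coefZ coefXn eqxx mulr1 mulnS mulr0 subr0 !add0r.
pose a k := B k / k`!%:R - p`_k.
suff : a (2 * i.+1)%N = 0 by move/eqP; rewrite subr_eq0 p_coef => /eqP.
pose s x := x / (expR x - 1) - p.[x].
have p2 : 0 < 2 * pi :> R by rewrite mulr_gt0// pi_gt0.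
apply: (@power_series_coef_eq0 R a s (2 * pi) C (2 * i.+2)) => //.
- move=> x x2.
  have -> : series (fun k => a k * x ^+ k) =
      series (fun k => B k / k`!%:R * x ^+ k) - series (fun k => p`_k * x ^+ k).
    rewrite -seriesN -seriesD; congr series; apply/funext => k.
    by rewrite !fctE /a mulrBl.
  apply: cvgB; first exact: bernoulli_numbers_real.
  apply: cvg_near_cst; near=> n.
  rewrite /series/= big_mkord (@horner_coef_wide _ n)//.
  by near: n; exact: nbhs_infty_ge.
- by move=> x /andP[x0 _]; rewrite /s pE; apply: CP.
- by rewrite ltn_mul2l ltnSn.
Unshelve. all: by end_near. Qed.

(** * The theorem *)

(** Over the complex numbers, A^2 + 4 pi^2 k^2 is the product of A - 2 i pi k and
    A + 2 i pi k. *)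
Lemma shifted_square_unit (R : realType) (d : nat) (A : 'M[R]_d.+1) :
  (forall k : int, k != 0 ->
    ~~ eigenvalue (map_mx (real_complex R) A) (0 +i* (2 * pi * k%:~R))) ->
  forall k, (0 < k)%N -> shifted_square A k \in unitmx.
Proof.
move=> hA k k0; pose Ac : 'M[R[i]]_d.+1 := map_mx (real_complex R) A.
pose z (j : int) : R[i] := 0 +i* (2 * pi * j%:~R).
have unit_sub j : j != 0 -> Ac - (z j)%:M \is a GRing.unit.
  move=> /hA; rewrite /eigenvalue /eigenspace negbK kermx_eq0 row_free_unit.
  by [].
have pp : 2 * pi != 0 :> R by rewrite mulf_neq0// gt_eqF ?pi_gt0.
have p2 : (2 * pi) ^+ 2 != 0 :> R by rewrite expf_neq0.
have zN j : z (- j) = - z j.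
  by apply/eqP; rewrite eq_complex/= mulrNz mulrN oppr0 !eqxx.
have zz : z k * z k = - ((2 * pi * k%:R) ^+ 2)%:C.
  apply/eqP; rewrite eq_complex/= !(mul0r, mulr0) sub0r addr0 expr2 oppr0.
  by rewrite !eqxx.
have factor : map_mx (real_complex R) ((2 * pi) ^+ 2 *: shifted_square A k) =
    (Ac - (z k)%:M) *m (Ac - (z (- k%:Z))%:M).
  rewrite /shifted_square scalerDr [(_ *: A) ^+ _]exprZn scalerA -exprMn mulfV//.
  rewrite expr1n scale1r scale_scalar_mx -exprMn map_mxD map_scalar_mx/=.
  rewrite -[map_mx _ _]/(map_mx (real_complex R) (A *m A)) map_mxM -/Ac.
  rewrite zN raddfN/= opprK mulmxBl !mulmxDr !mul_scalar_mx mul_mx_scalar.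
  rewrite scale_scalar_mx zz opprD addrA addrK.
  by rewrite raddfN/= opprK.
have : map_mx (real_complex R) ((2 * pi) ^+ 2 *: shifted_square A k) \in unitmx.
  by rewrite factor unitmx_mul; apply/andP; split; apply: unit_sub;
    rewrite ?oppr_eq0 -?lt0n// eqz_nat -lt0n.
by rewrite map_unitmx unitmxZ ?unitfE.
Qed.

Theorem theorem2 (R : realType) (B : nat -> R) (hB : bernoulli_numbers B)
    (d : nat) (A : 'M[R]_d)
    (hA : forall k : int, k != 0 ->
      ~~ eigenvalue (map_mx (real_complex R) A) (0 +i* (2 * pi * k%:~R)))
    (n : nat) (hn : (0 < n)%N) :
  [/\ phi1_mx A \in unitmx,
      forall k : nat, (0 < k)%N -> shifted_square A k \in unitmx,
      cvgn (series (fun k => psi1_term n A k.+1)) &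
      psi1_mx A = psi1_poly_part B n A
        + (2 * (-1) ^+ n) *: limn (series (fun k => psi1_term n A k.+1))].
Proof.
(* Evaluation of polynomials at a matrix needs a positive dimension. *)
case: d A hA => [|d] A hA.
  have unit0 (M : 'M[R]_0) : M \in unitmx by rewrite unitmxE det_mx00 unitr1.
  split => //; last by rewrite [LHS]flatmx0 [RHS]flatmx0.
  apply/cvg_ex; exists 0; apply: cvg_near_cst; near=> m.
  by rewrite [LHS]flatmx0.
have uA := shifted_square_unit hA.
have [uphi expansion] := psi1_mx_expansion n uA.
split => //; first by have [] := psi1_series_cvg n uA.
rewrite expansion /psi1_poly_part; congr (_ + _ + _); apply: eq_bigr => i _.
by rewrite bernoulli_number_coef.
Unshelve. all: by end_near. Qed.
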